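(* For every positive integer $k$ and every constant $\varepsilon>0$, there is no polynomial time algorithm (in the value and independence oracle model) for maximizing a non-negative linear function over a $k$-extendible system that achieves an approximation ratio of $k-\varepsilon$.
   Context: An independence system on a finite ground set $\mathcal{N}$ of size $n$ is a non-empty family $\mathcal{I}\subseteq2^{\mathcal{N}}$ closed under subsets; it is $k$-extendible if for all $A\subseteq B\in\mathcal{I}$ and $u\notin B$ with $A\cup\{u\}\in\mathcal{I}$ there is $Y\subseteq B\setminus A$, $|Y|\le k$, with $(B\setminus Y)\cup\{u\}\in\mathcal{I}$. A linear (modular) function has the form $f(S)=\sum_{u\in S}c_u+b$. The algorithm accesses $f$ only through a value oracle and $\mathcal{I}$ only through an independence oracle, and ''polynomial time'' means polynomially many (in $n$) oracle queries; the algorithm may be randomized. An approximation ratio of $\alpha$ means the (expected) value of the output independent set is at least $f(OPT)/\alpha$ on every instance, where $OPT$ maximizes $f$ over $\mathcal{I}$. The hardness is information-theoretic (independent of $P\ne NP$). *)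

(* Defs.v *)
From HB Require Import structures.
From mathcomp Require Import all_boot all_order all_algebra.
From mathcomp Require Import all_classical all_reals all_analysis.

Set Implicit Arguments.
Unset Strict Implicit.
Unset Printing Implicit Defensive.
Import Order.TTheory GRing.Theory Num.Theory.
Local Open Scope ring_scope.

Definition independence_system (N : finType) (I : {set {set N}}) : Prop :=
  (exists A : {set N}, A \in I) /\
  (forall A B : {set N}, A \subset B -> B \in I -> A \in I).

Definition k_extendible (k : nat) (N : finType) (I : {set {set N}}) : Prop :=
  independence_system I /\
  forall (A B : {set N}) (u : N),
    A \subset B -> B \in I -> u \notin B -> (u |: A)%SET \in I ->
    exists Y : {set N},
      [/\ Y \subset (B :\: A)%SET, (#|Y| <= k)%N
        & (u |: (B :\: Y))%SET \in I].

Definition linear_setfun (R : realType) (N : finType) (f : {set N} -> R) : Prop :=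
  exists (c : N -> R) (b : R), forall S : {set N}, f S = \sum_(u in S) c u + b.

Definition nonneg_setfun (R : realType) (N : finType) (f : {set N} -> R) : Prop :=
  forall S : {set N}, 0 <= f S.

(* A deterministic, adaptive oracle algorithm on a fixed ground set: a          *)
(* well-founded decision tree which branches on the oracle answers. Computation *)
(* between two queries is free and unrestricted.                                *)
Inductive strategy (R : Type) (N : finType) : Type :=
| Output of {set N}
| AskValue of {set N} & (R -> strategy R N)
| AskIndep of {set N} & (bool -> strategy R N).

Fixpoint output (R : Type) (N : finType) (f : {set N} -> R) (I : {set {set N}})
    (s : strategy R N) : {set N} :=
  match s with
  | Output X => X
  | AskValue X next => output f I (next (f X))
  | AskIndep X next => output f I (next (X \in I))
  end.

Fixpoint queries (R : Type) (N : finType) (f : {set N} -> R) (I : {set {set N}})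
    (s : strategy R N) : nat :=
  match s with
  | Output _ => 0%N
  | AskValue X next => (queries f I (next (f X))).+1
  | AskIndep X next => (queries f I (next (X \in I))).+1
  end.

(* A randomized algorithm draws its deterministic strategy according to an      *)
(* arbitrary probability space, which may depend on the size n of the ground    *)
(* set; the ground set is identified with 'I_n.                                 *)
Record randomized_algorithm (R : realType) := RandomizedAlgorithm {
  seed_display : nat -> measure_display;
  seed : forall n : nat, measurableType (seed_display n);
  seed_law : forall n : nat, probability (seed n) R;
  seeded_strategy : forall n : nat, seed n -> strategy R 'I_n
}.

Definition instance (R : realType) (k n : nat)
    (f : {set 'I_n} -> R) (I : {set {set 'I_n}}) : Prop :=
  [/\ linear_setfun f, nonneg_setfun f & k_extendible k I].

Definition polynomial_time (R : realType) (k : nat)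
    (alg : randomized_algorithm R) : Prop :=
  exists p : {poly nat},
    forall (n : nat) (f : {set 'I_n} -> R) (I : {set {set 'I_n}}),
      instance k f I ->
      forall w : seed alg n, (queries f I (seeded_strategy w) <= p.[n])%N.

(* Measurability of the output events is what makes the expectation meaningful. *)
(* The condition 0 < alpha excludes the degenerate values for which             *)
(* f OPT / alpha would be nonpositive (with x / 0 = 0).                         *)
Definition achieves_ratio (R : realType) (k : nat) (alg : randomized_algorithm R)
    (alpha : R) : Prop :=
  0 < alpha /\
  forall (n : nat) (f : {set 'I_n} -> R) (I : {set {set 'I_n}}),
    instance k f I ->
    let out := fun w : seed alg n => output f I (seeded_strategy w) in
    [/\ forall S : {set 'I_n}, measurable [set w | out w = S]%classic,
        forall w : seed alg n, out w \in I
      & forall OPT : {set 'I_n},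
          OPT \in I -> (forall S : {set 'I_n}, S \in I -> f S <= f OPT) ->
          ((f OPT / alpha)%:E <= 'E_(seed_law alg n)[fun w => f (out w)])%E].

(* Main.v *)
Require Import Defs.
From mathcomp Require Import all_boot all_order all_algebra.
From mathcomp Require Import all_classical all_reals all_analysis.
From mathcomp Require Import zify ring lra.
From mathcomp Require Import fintype finset.

Set Implicit Arguments.
Unset Strict Implicit.
Unset Printing Implicit Defensive.
Import Order.TTheory GRing.Theory Num.Theory.
Local Open Scope ring_scope.

(** Give every element weight k, except that the elements of a hidden set H
    beyond the first t weigh 1, and call a set independent if its weight is at
    most k m.  All marginal weights lie between 1 and k, which makes the system
    k-extendible.  With f the cardinality and |H| = k (m - t) + t, the set H is
    independent, so the optimum is about k m when t << m.  On the other hand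
    a query S can be told apart from the same query with an empty H (the uniform
    matroid of rank m) only if |S| <= k m and |S :&: H| > t.  For H a uniformly
    random transversal of a |H| x k m grid, the moment bound
    E[2 ^ |S :&: H|] <= e makes this an event of probability at most e / 2 ^ t, so
    polynomially many queries behave as for the uniform matroid and the
    algorithm returns about m elements on average. *)

(** * The hidden system: extendibility and indistinguishability *)

Section HiddenSystem.
Local Open Scope nat_scope.

(** Taking [H = set0] gives weight [k * #|S|], so for positive [k] the uniform matroid of rank [m]
    is itself a hidden system. *)
Definition hidden_weight (N : finType) (k t : nat) (H S : {set N}) : nat :=
  k * minn #|S :&: H| t + (#|S :&: H| - t) + k * #|S :\: H|.

Definition hidden_system (N : finType) (k m t : nat) (H : {set N}) :
  {set {set N}} := [set S | hidden_weight k t H S <= k * m].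

Variables (N : finType) (k m t : nat) (H : {set N}).
Hypothesis k_gt0 : 0 < k.
Implicit Types (A B S Y : {set N}) (u : N).

Lemma exists_subset_card A n :
  n <= #|A| -> exists2 Y : {set N}, Y \subset A & #|Y| = n.
Proof.
move=> /card_geqP[s [s_uniq s_size s_sub]]; exists [set x in s].
  by apply/subsetP => x; rewrite inE => /s_sub.
by rewrite cardsE -s_size; apply/card_uniqP.
Qed.

Lemma hidden_weight_setD Y B :
  Y \subset B -> hidden_weight k t H (B :\: Y) + #|Y| <= hidden_weight k t H B.
Proof.
move=> YB; rewrite /hidden_weight.
have cap : #|B :&: H| = #|(B :\: Y) :&: H| + #|Y :&: H|.
  rewrite -(cardsID Y (B :&: H)) addnC; congr (_ + _).
    by apply: eq_card => x; rewrite !inE andbA.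
  by apply: eq_card => x; rewrite !inE; case: (boolP (x \in Y)) => [/(subsetP YB)->|];
    rewrite ?andbF ?andbT.
have dif : #|B :\: H| = #|(B :\: Y) :\: H| + #|Y :\: H|.
  rewrite -(cardsID Y (B :\: H)) addnC; congr (_ + _).
    by apply: eq_card => x; rewrite !inE andbCA.
  by apply: eq_card => x; rewrite !inE; case: (boolP (x \in Y)) => [/(subsetP YB)->|];
    rewrite ?andbF ?andbT.
have := cardsID H Y; rewrite cap dif.
move: #|_ :&: H| #|_ :&: H| #|_ :\: H| #|_ :\: H| #|Y| => a b c d y <-.
have bd : b + d <= k * b + k * d by rewrite leq_add ?leq_pmull.
by have [?|?] := leqP (a + b) t; have [?|?] := leqP a t; nia.
Qed.

(** A new element raises exactly one of the three terms, by [k] or by 1. *)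
Lemma hidden_weight_setU1 u S :
  hidden_weight k t H (u |: S) <= hidden_weight k t H S + k.
Proof.
have [uS|uNS] := boolP (u \in S).
  by rewrite (setUidPr _) ?sub1set ?leq_addr.
rewrite /hidden_weight setIUl setDUl.
have [uH|uNH] := boolP (u \in H).
  have -> : [set u] :&: H = [set u] by apply/setIidPl; rewrite sub1set.
  have -> : [set u] :\: H = set0 by apply/eqP; rewrite setD_eq0 sub1set.
  rewrite set0U cardsU1 inE (negPf uNS) /=.
  move: #|_| #|_| => a b.
  by have [?|?] := leqP (1 + a) t; have [?|?] := leqP a t; nia.
have -> : [set u] :&: H = set0.
  by apply/setP => x; rewrite !inE; apply/andP => -[/eqP->]; apply/negP.
have -> : [set u] :\: H = [set u].
  by apply/setP => x; rewrite !inE andbC; case: eqP => [->|].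
rewrite set0U cardsU1 inE (negPf uNS) andbF /=; lia.
Qed.

Lemma hidden_weight_le S : hidden_weight k t H S <= k * #|S|.
Proof. by rewrite /hidden_weight -(cardsID H S); nia. Qed.

Lemma hidden_weight_ge S : #|S| <= hidden_weight k t H S.
Proof. by rewrite /hidden_weight -(cardsID H S); nia. Qed.

Lemma hidden_weight_small S :
  #|S :&: H| <= t -> hidden_weight k t H S = k * #|S|.
Proof.
move=> le_t; rewrite /hidden_weight -(cardsID H S) (minn_idPl _) //; nia.
Qed.

(* Every element has marginal weight between 1 and k, so trading any k elements
   of B for u cannot increase the weight. *)
Lemma hidden_system_extendible : k_extendible k (hidden_system k m t H).
Proof.
have sub A B : A \subset B -> B \in hidden_system k m t H ->
    A \in hidden_system k m t H.
  rewrite !inE => AB; apply: leq_trans.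
  have -> : A = B :\: (B :\: A) by rewrite setDDr setDv set0U (setIidPr AB).
  exact: leq_trans (leq_addr _ _) (hidden_weight_setD (subsetDl B A)).
split.
  split; last exact: sub.
  by exists set0; rewrite inE (leq_trans (hidden_weight_le _)) // cards0 muln0.
move=> A B u AB BI uNB uAI.
(* A difference of at most [k] elements is dropped whole, which leaves [u |: A]. *)
have [le_k|/ltnW lt_k] := leqP #|B :\: A| k.
  exists (B :\: A); split=> //.
  by rewrite setDDr setDv set0U (setIidPr AB).
have [Y Ysub Ycard] := exists_subset_card lt_k.
exists Y; split; rewrite ?Ycard //.
move: BI; rewrite !inE; apply: leq_trans.
apply: leq_trans (hidden_weight_setU1 _ _) _; rewrite -{2}Ycard.
by apply: hidden_weight_setD; apply: subset_trans Ysub (subsetDl _ _).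
Qed.

(** The weight is exactly [k * m]: [t] elements of weight [k] and [k * (m - t)] of weight 1. *)
Lemma mem_hidden_set : t <= m -> #|H| = k * (m - t) + t ->
  H \in hidden_system k m t H.
Proof.
move=> le_tm cH; rewrite inE /hidden_weight setIid setDv cards0 muln0 cH.
rewrite (minn_idPr _) ?leq_addl // addnK; nia.
Qed.

Lemma card_hidden_system S : S \in hidden_system k m t H -> #|S| <= k * m.
Proof. by rewrite inE; apply: leq_trans (hidden_weight_ge _). Qed.

Lemma hidden_system_small S :
  #|S :&: H| <= t -> (S \in hidden_system k m t H) = (#|S| <= m).
Proof. by move=> le_t; rewrite inE hidden_weight_small // leq_pmul2l. Qed.

(** A set of more than [k * m] elements fails both tests, and one meeting [H] in at most [t]
    elements has weight [k * #|S|]. *)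
Lemma hidden_system_distinguish S :
  (S \in hidden_system k m t H) != (#|S| <= m) ->
  (#|S| <= k * m) && (t < #|S :&: H|).
Proof.
move=> ne; rewrite andbC ltnNge; apply/andP; split.
  by apply: contra ne => le_t; rewrite hidden_system_small.
have [/card_hidden_system//|SnI] := boolP (S \in hidden_system k m t H).
move: ne; rewrite (negPf SnI); case: leqP => // le_m _.
by apply: leq_trans le_m (leq_pmull _ _).
Qed.

End HiddenSystem.

(** * Comparing the runs of a strategy *)

(** Union bound along the single run against [I0]: the run for [phi] follows it until an
    independence answer differs, and value answers never differ. *)
Lemma output_differs_card (R : Type) (N T : finType) (f : {set N} -> R)
    (I : T -> {set {set N}}) (I0 : {set {set N}}) (b : nat) (s : strategy R N) :
    (forall X, #|[set phi | (X \in I phi) != (X \in I0)]%SET| <= b)%N ->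
  (#|[set phi | output f (I phi) s != output f I0 s]%SET| <= queries f I0 s * b)%N.
Proof.
move=> bP; elim: s => [X|X s IH|X s IH] /=.
- rewrite (_ : [set _ | _]%SET = set0) ?cards0 //.
  by apply/setP => phi; rewrite !inE eqxx.
- by apply: leq_trans (IH _) _; rewrite mulSn leq_addl.
rewrite mulSn; apply: leq_trans (leq_add (bP X) (IH (X \in I0))).
apply: leq_trans (subset_leq_card _) (leq_card_setU _ _).
apply/subsetP => phi; rewrite !inE.
by case: (eqVneq (X \in I phi) (X \in I0)) => [->|].
Qed.

(** * Random transversals and their tail bound *)

Section RandomTransversal.
Local Open Scope nat_scope.
Variables r q : nat.

(** One cell per row of an [r] by [q] grid; [mxvec_index] flattens the grid into an ordinal, as
    algorithms require. A uniform [phi] makes the rows independent. *)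
Definition transversal_set (phi : {ffun 'I_r -> 'I_q}) : {set 'I_(r * q)} :=
  [set mxvec_index j (phi j) | j : 'I_r].

Lemma mxvec_index_inj (i j : 'I_r) (v w : 'I_q) :
  mxvec_index i v = mxvec_index j w -> (i, v) = (j, w).
Proof.
case: (curry_mxvec_bij r q) => g gK _ e.
by rewrite -(gK (i, v)) ?inE //= e -[RHS]gK ?inE.
Qed.

Lemma card_transversal_set phi : #|transversal_set phi| = r.
Proof.
rewrite card_imset ?card_ord // => i j.
by move/mxvec_index_inj => -[].
Qed.

Lemma card_setI_transversal_set (S : {set 'I_(r * q)}) phi :
  #|S :&: transversal_set phi| = \sum_j (mxvec_index j (phi j) \in S).
Proof.
rewrite setIC -sum1dep_card big_mkcondr /= big_imset /=; last first.
  by move=> i j _ _ /mxvec_index_inj -[].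
by apply: eq_big => // j _; case: ifP.
Qed.

(** The moment factors over the independent rows, and [2 ^ x = 1 + x] for a truth value [x]. *)
Lemma sum_exp2_setI_transversal_set (S : {set 'I_(r * q)}) :
  \sum_phi 2 ^ #|S :&: transversal_set phi| =
  \prod_(j < r) (q + \sum_v (mxvec_index j v \in S)).
Proof.
transitivity (\prod_(j < r) \sum_(v < q) 2 ^ (mxvec_index j v \in S)).
  rewrite bigA_distr_bigA /=; apply: eq_bigr => phi _.
  by rewrite card_setI_transversal_set expn_sum.
apply: eq_bigr => j _; rewrite -[X in X + _](card_ord q) -sum1_card -big_split /=.
by apply: eq_bigr => v _; case: (_ \in _).
Qed.

Lemma sum_mxvec_index_in (S : {set 'I_(r * q)}) :
  \sum_(j < r) \sum_(v < q) (mxvec_index j v \in S) = #|S|.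
Proof.
rewrite pair_big /= -sum1_card [RHS]big_mkcond /=.
rewrite [RHS](reindex (uncurry (@mxvec_index r q))) /=; last first.
  by apply: subon_bij (curry_mxvec_bij r q).
by apply: eq_big => -[j v] //= _; case: ifP.
Qed.

End RandomTransversal.

(** Markov's inequality for [2 ^ #|S :&: H|]. A row with [s] cells in [S] contributes [q + s], at
    most [q * expR (s / q)], and these [s] sum to [#|S| <= q]. *)
Lemma transversal_tail (R : realType) (r q t : nat) (S : {set 'I_(r * q)}) :
  (0 < q)%N -> (#|S| <= q)%N ->
  (#|[set phi | (t < #|S :&: transversal_set phi|)%N]%SET| * 2 ^ t)%:R
    <= (q ^ r)%:R * expR 1 :> R.
Proof.
move=> q0 Sq.
apply: (@le_trans _ _ (\sum_phi 2 ^ #|S :&: transversal_set phi|)%N%:R).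
  rewrite ler_nat -sum_nat_const big_mkcond /=; apply: leq_sum => phi _.
  by case: ifP => //; rewrite inE => /ltnW; rewrite leq_exp2l.
rewrite sum_exp2_setI_transversal_set natr_prod.
apply: (@le_trans _ _ (\prod_(j < r)
    (q%:R * expR ((\sum_v (mxvec_index j v \in S))%N%:R / q%:R)))).
  apply: ler_prod => j _; rewrite ler0n /=.
  apply: le_trans (ler_wpM2l (ler0n _ _) (expR_ge1Dx _)).
  by rewrite mulrDr mulr1 mulrCA divff ?mulr1 ?natrD // pnatr_eq0 -lt0n.
rewrite big_split /= prodr_const card_ord -expR_sum natrX.
rewrite ler_wpM2l ?exprn_ge0 ?ler0n // ler_expR -mulr_suml -natr_sum.
by rewrite sum_mxvec_index_in ler_pdivrMr ?ltr0n // mul1r ler_nat.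
Qed.

(** * Measurability and expectation *)

(** The function is a finite combination of indicators of the output events. *)
Lemma measurable_finite_comp (R : realType) (d : measure_display)
    (T : measurableType d) (N : finType) (out : T -> N) (g : N -> R) :
    (forall S, measurable [set w | out w = S]%classic) ->
  measurable_fun [set: T]%classic (fun w => g (out w)).
Proof.
move=> mout.
rewrite (_ : (fun w => _) = fun w =>
    \sum_(S <- index_enum N) g S * \1_([set w | out w = S]%classic) w); last first.
  apply/boolp.funext => w; rewrite (bigD1 (out w)) //= big1 => [|S neS].
    by rewrite indicE mem_set // mulr1 addr0.
  by rewrite indicE memNset ?mulr0 //= => e; rewrite e eqxx in neS.
apply: measurable_sum => S; apply: measurable_realfun.measurable_funM; first exact: measurable_cst.
exact: measurable_realfun.measurable_indic.
Qed.

(** Exchanging sum and expectation reduces a randomized algorithm to a bound for each fixed seed. *)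
Lemma sum_expectation_le (R : realType) (d : measure_display)
    (T : measurableType d) (P : probability T R) (J : finType)
    (X : J -> T -> R) (c : R) :
    (forall j, measurable_fun [set: T]%classic (X j)) ->
    (forall j w, 0 <= X j w) -> (forall w, \sum_j X j w <= c) ->
  (\sum_j 'E_P[X j] <= c%:E)%E.
Proof.
move=> mX X0 Xc; 
rewrite (eq_bigr (fun j => \int[P]_w (X j w)%:E)%E); last first.
  by move=> j _; rewrite unlock.
rewrite -(@ge0_integral_sum _ _ _ P _ _ _ (fun j w => (X j w)%:E)) //; last 2 first.
- by move=> j; apply/measurable_realfun.measurable_EFinP; exact: mX.
- by move=> j w _; rewrite lee_fin.
rewrite -[leRHS]mule1 -(probability_setT P) -integral_cst //.
apply: ge0_le_integral => //=.
- by move=> w _; rewrite sume_ge0 // => j _; rewrite lee_fin.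
- by apply: emeasurable_sum => j; apply/measurable_realfun.measurable_EFinP; exact: mX.
- by move=> w _; rewrite sumEFin lee_fin.
Qed.

(** * Growth estimates *)

Lemma horner_nat_le (p : {poly nat}) :
  exists c e : nat, forall n : nat, (p.[n] <= c * n.+1 ^ e)%N.
Proof.
elim/poly_ind: p => [|p a [c [e IH]]].
  by exists 0%N, 0%N => n; rewrite horner0.
exists (c + a)%N, e.+1 => n; rewrite hornerMXaddC expnS.
have := IH n; have := expn_gt0 n.+1 e => /=.
move: p.[n] (n.+1 ^ e)%N => x y y_gt0 le_xy.
change (x * n + a <= (c + a) * (n.+1 * y))%N; nia.
Qed.

Lemma monomial_le_exp2 (c e : nat) :
  exists2 t : nat, (0 < t)%N & (c * t ^ e <= 2 ^ t)%N.
Proof.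
(* With [t] a power of two only exponents are compared:
   [c + 4 * a * e <= a.+1 ^ 4 <= 2 ^ (4 * a)]. *)
pose a := (c + e)%N; exists (2 ^ (4 * a))%N; first by rewrite expn_gt0.
apply: (@leq_trans (2 ^ c * 2 ^ (4 * a * e))%N).
  by rewrite -expnM leq_mul2r (ltnW (ltn_expl c _)) ?orbT.
rewrite -expnD leq_exp2l // mulnC expnM.
apply: (@leq_trans (a.+1 ^ 4)%N); last first.
  by rewrite -expnM mulnC expnM leq_exp2r // ltn_expl.
have : (c <= a /\ e <= a)%N by rewrite /a; lia.
rewrite !expnS expn0; move: a => {}a; nia.
Qed.

(** * Averaging over the hidden sets *)

Lemma card_instance (R : realType) (k n : nat) (I : {set {set 'I_n}}) :
  k_extendible k I -> instance k (fun S : {set 'I_n} => #|S|%:R : R) I.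
Proof.
move=> extI; split=> //.
by exists (fun=> 1), 0 => S; rewrite sumr_const addr0.
Qed.

Section Averaging.
Variables (R : realType) (k m t Q : nat).
(** [r] is the size of the hidden set. With [q] columns, a query of at most [q] elements meets a
    random transversal in at most one element on average. *)
Let r := (k * (m - t) + t)%N.
Let q := (k * m)%N.
Variables (alg : randomized_algorithm R) (alpha : R).
Hypotheses (k_gt0 : (0 < k)%N) (m_gt0 : (0 < m)%N) (t_le_m : (t <= m)%N).
Hypothesis alg_ratio : achieves_ratio k alg alpha.
Hypothesis alg_queries :
  forall (f : {set 'I_(r * q)} -> R) (I : {set {set 'I_(r * q)}}),
    instance k f I -> forall w, (queries f I (seeded_strategy (r:=alg) w) <= Q)%N.

Let f (S : {set 'I_(r * q)}) : R := #|S|%:R.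
Let system (H : {set 'I_(r * q)}) := hidden_system k m t H.
Let out H (w : seed alg (r * q)) := output f (system H) (seeded_strategy w).

Lemma hidden_instance H : instance k f (system H).
Proof. exact: card_instance (hidden_system_extendible m t H k_gt0). Qed.

Let q_gt0 : (0 < q)%N.
Proof. by rewrite muln_gt0 k_gt0. Qed.

(** The tail bound rounded down: how many [phi] one query can tell from the uniform matroid. *)
Let b := Num.truncn ((q ^ r)%:R * expR 1 / 2 ^+ t : R).

Lemma distinguish_card (X : {set 'I_(r * q)}) :
  (#|[set phi | (X \in system (transversal_set phi)) != (X \in system set0)]%SET|
     <= b)%N.
Proof.
have X0 : (X \in system set0) = (#|X| <= m)%N.
  by rewrite hidden_system_small // setI0 cards0.
have b_ge0 : 0 <= (q ^ r)%:R * expR 1 / 2 ^+ t :> R.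
  by rewrite divr_ge0 ?exprn_ge0 // mulr_ge0 ?ler0n ?expR_ge0.
have [Xq|Xq] := leqP #|X| q; last first.
  rewrite (_ : [set _ | _]%SET = set0) ?cards0 //.
  apply/setP => phi; rewrite in_set in_set0 X0; apply/negbTE/negP.
  by move=> /(hidden_system_distinguish k_gt0); rewrite leqNgt Xq.
rewrite truncn_ge_nat // ler_pdivlMr ?exprn_gt0 // -natrX -natrM.
apply: le_trans (transversal_tail R t q_gt0 Xq).
rewrite ler_nat leq_mul2r subset_leq_card ?orbT //.
apply/subsetP => phi; rewrite in_set X0.
by case/(hidden_system_distinguish k_gt0)/andP => _; rewrite in_set.
Qed.

(** For a fixed seed, all but [Q * b] choices of [phi] give the output for the uniform matroid, of
    size at most [m]; elsewhere feasibility still bounds the size by [k * m]. *)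
Lemma sum_output_le w :
  \sum_(phi : {ffun 'I_r -> 'I_q}) f (out (transversal_set phi) w) <=
  (q ^ r)%:R * m%:R + (k * m)%:R * (Q%:R * b%:R).
Proof.
pose bad := [set phi : {ffun 'I_r -> 'I_q} |
  out (transversal_set phi) w != out set0 w]%SET.
have out_in H : out H w \in system H.
  by have [_ + _] := alg_ratio.2 _ _ _ (hidden_instance H); exact.
have card_bad : (#|bad| <= Q * b)%N.
  apply: leq_trans (output_differs_card f (seeded_strategy w) distinguish_card) _.
  by rewrite leq_mul2r (alg_queries (hidden_instance set0)) orbT.
apply: (@le_trans _ _ (#|{ffun 'I_r -> 'I_q}| * m + k * m * #|bad|)%N%:R).
  rewrite /f -natr_sum ler_nat [(_ * #|bad|)%N]mulnC -!sum_nat_const.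
  rewrite [X in (_ <= _ + X)%N]big_mkcond -big_split /=; apply: leq_sum => phi _; rewrite inE.
  have [->|_] /= := eqVneq; last first.
    by rewrite (leq_trans (card_hidden_system k_gt0 (out_in _))) // leq_addl.
  by have := out_in set0; rewrite hidden_system_small ?setI0 ?cards0 // addn0.
rewrite card_ffun !card_ord natrD !natrM lerD2l -natrM ler_wpM2l ?ler0n //.
by rewrite -natrM ler_nat.
Qed.

Lemma ratio_bound :
  r%:R / alpha <= m%:R + (k * m)%:R * Q%:R * expR 1 / 2 ^+ t.
Proof.
have [alpha_gt0 ratio] := alg_ratio.
have le_exp phi :
    ((r%:R / alpha)%:E <= 'E_(seed_law alg (r * q))[
       fun w => f (out (@transversal_set r q phi) w)])%E.
  have Hin : transversal_set phi \in system (transversal_set phi).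
    by rewrite mem_hidden_set // card_transversal_set.
  have [_ _ optP] := ratio _ _ _ (hidden_instance (transversal_set phi)).
  (* The guarantee speaks of a maximizer; its size is at least [r] because the transversal is
     independent. *)
  have [OPT OPTin OPTmax] := arg_maxnP (fun S : {set _} => #|S|) Hin.
  apply: le_trans (optP OPT OPTin _) => [|S SI].
    rewrite lee_fin ler_pM2r ?invr_gt0 // /f ler_nat.
    by rewrite -[leqLHS](card_transversal_set phi); apply: OPTmax.
  by rewrite ler_nat; apply: OPTmax.
have : (\sum_(phi : {ffun 'I_r -> 'I_q}) (r%:R / alpha)%:E <=
    ((q ^ r)%:R * m%:R + (k * m)%:R * (Q%:R * b%:R))%:E)%E.
  apply: le_trans (lee_sum _ (fun phi _ => le_exp phi)) _.
  apply: sum_expectation_le => [phi|phi w|w]; last exact: sum_output_le.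
    have [mout _ _] := ratio _ _ _ (hidden_instance (transversal_set phi)).
    exact: measurable_finite_comp.
  by rewrite ler0n.
rewrite sumEFin lee_fin sumr_const card_ffun !card_ord -[leLHS]mulr_natl => le_sum.
have qr_gt0 : 0 < (q ^ r)%:R :> R by rewrite ltr0n expn_gt0 q_gt0.
rewrite -(ler_pM2l qr_gt0); apply: le_trans le_sum _.
rewrite mulrDr lerD2l [leRHS](_ : _ =
  (k * m)%:R * (Q%:R * ((q ^ r)%:R * expR 1 / 2 ^+ t))); last by ring.
by rewrite !ler_wpM2l ?ler0n // truncn_le // divr_ge0 ?exprn_ge0.
Qed.

End Averaging.

(** * Choice of parameters and contradiction *)

Theorem theorem43 (R : realType) (k : nat) (eps : R) (hk : (0 < k)%N) (heps : 0 < eps) :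
  ~ exists alg : randomized_algorithm R,
      polynomial_time k alg /\ achieves_ratio k alg (k%:R - eps).
Proof.
move=> [alg [[p alg_poly] alg_ratio]].
(* [s] is the ratio of [m] to [t]. The gain [eps * m] must exceed both the loss [k * t] in the
   optimum and the at most [k] due to the error term. *)
pose s := Num.bound (2 * k%:R / eps : R).
have k_gt0 : 0 < k%:R :> R by rewrite ltr0n.
have s_big : 2 * k%:R < eps * s%:R.
  rewrite [ltRHS]mulrC -ltr_pdivrMr // archi_boundP // divr_ge0 ?ltW //.
  by rewrite mulr_gt0.
have s_gt0 : (0 < s)%N.
  by rewrite -(ltr0n R) -(pmulr_rgt0 _ heps); apply: le_lt_trans s_big; lra.
pose E := Num.bound (expR 1 : R).
have E_ge : expR 1 <= E%:R :> R by rewrite ltW // archi_boundP // expR_ge0.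
have [c [e p_le]] := horner_nat_le p.
(* Since [m = s * t] and [n.+1 <= (2 * k * s * t) ^ 2], the error numerator [k * m * p.[n] * E] is
   at most this constant times [t ^ (2 * e).+1]. *)
have [t t_gt0 t_big] :=
  monomial_le_exp2 (k * s * c * (2 * k * s) ^ (2 * e) * E) (2 * e).+1.
pose m := (s * t)%N; pose r := (k * (m - t) + t)%N; pose n := (r * (k * m))%N.
have m_gt0 : (0 < m)%N by rewrite muln_gt0 s_gt0.
have t_le_m : (t <= m)%N by rewrite leq_pmull.
have n_le : (n.+1 <= (2 * k * s * t) ^ 2)%N.
  have r_le : (r <= k * m)%N by rewrite /r; nia.
  have km_gt0 : (0 < k * m)%N by rewrite muln_gt0 hk.
  rewrite -mulnA -/m -mulnA expnMn /n; nia.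
have queries_le (f : {set 'I_n} -> R) (I : {set {set 'I_n}}) :
    instance k f I -> forall w, (queries f I (seeded_strategy (r:=alg) w) <= p.[n])%N.
  exact: alg_poly.
have := ratio_bound hk m_gt0 t_le_m alg_ratio queries_le.
rewrite -/r ler_pdivrMr; last exact: alg_ratio.1.
have small : (k * m)%:R * p.[n]%:R * expR 1 / 2 ^+ t <= 1 :> R.
  rewrite ler_pdivrMr ?exprn_gt0 // mul1r.
  apply: (@le_trans _ _ ((k * m)%:R * p.[n]%:R * E%:R)).
    by rewrite ler_wpM2l // mulr_ge0 ?ler0n.
  rewrite -!natrM -natrX ler_nat; apply: leq_trans t_big.
  rewrite expnS [leqRHS](_ : _ =
    k * m * (c * (2 * k * s * t) ^ (2 * e)) * E)%N; last first.
    rewrite [((2 * k * s * t) ^ _)%N]expnMn /m.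
    by move: (_ ^ _)%N (_ ^ _)%N => a b; lia.
  rewrite leq_mul2r leq_mul2l; apply/orP; right; apply/orP; right.
  apply: leq_trans (p_le n) _; rewrite leq_mul2l expnM.
  by apply/orP; right; case: (e) => // e'; rewrite leq_exp2r.
have r_ge : k%:R * (s%:R * t%:R) - k%:R * t%:R <= r%:R :> R.
  rewrite lerBlDr -!natrM -natrD ler_nat /r /m.
  by rewrite mulnBr; lia.
have alpha_gt0 : 0 < k%:R - eps := alg_ratio.1.
move=> r_le.
have : r%:R <= (s%:R * t%:R + 1) * (k%:R - eps) :> R.
  by apply: le_trans r_le _; rewrite ler_pM2r // -[s%:R * t%:R]natrM -/m lerD2l.
have t_ge1 : 1 <= t%:R :> R by rewrite ler1n.
(* The bounds on [r] give [eps * s * t <= k * t + k - eps], which is below [2 * k * t] as [t >= 1],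
   against the choice of [s]. *)
have := ltr_pM2r (lt_le_trans ltr01 t_ge1) (2 * k%:R) (eps * s%:R).
rewrite s_big; nra.
Qed.
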